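(* Let $N(\cdot)$ be any cumulative distribution function on $\mathbb{R}$, let $\gamma\in\mathbb{R}$ be any threshold, let $|S_a|\ge 1$ be the (integer) width of the single anomaly event, let $q\in(0,1)$ be the anomaly ratio, and let the island width be $w_N=|S_a|$. If $q\le\frac13$, then the balanced point-adjusted F1 score of a detector whose anomaly scores are randomly generated noise with cdf $N$ satisfies $$F_{1BA}\le F1_{chance}=0.5 .$$
   Context: A time series of length $T$ has a single anomaly event $S_a$ (a contiguous set of $|S_a|$ time steps), and $q=|S_a|/T$. A random detector assigns i.i.d. scores with cdf $N$ to the time steps, and predicts an anomaly at $t$ when the score exceeds $\gamma$. Balanced point adjustment turns all of $S_a$ into positive predictions if at least one point of $S_a$ is predicted positive, and turns all points in an island of width $w_N$ around each false positive into positive predictions. $F_{1BA}$ is the F1 score of the adjusted predictions against the true labels. For random noise scores, $F_{1BA}$ denotes its limiting expression for sufficiently large time series: $$F_{1BA}=\frac{2q\left(1-N(\gamma)^{|S_a|}\right)}{\left(1-N(\gamma)^{w_N}\right)+q\left(1+N(\gamma)^{w_N}-N(\gamma)^{|S_a|}\right)}.$$ *)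

(* Defs.v *)
From HB Require Import structures.
From mathcomp Require Import all_boot all_order all_algebra.
From mathcomp Require Import all_classical all_reals all_analysis.

Set Implicit Arguments.
Unset Strict Implicit.
Unset Printing Implicit Defensive.

Import Order.TTheory GRing.Theory Num.Theory.
Import numFieldNormedType.Exports.

Local Open Scope ring_scope.

(* Limiting balanced point-adjusted F1 score of i.i.d. noise scores with cdf [N]
   at threshold [gamma]; [Sa] is the width of the anomaly event, [wN] the island
   width around a false positive and [q] the anomaly ratio. A
   [cumulativeBounded 0 1] is a nondecreasing right-continuous function tending
   to 0 at -oo and to 1 at +oo, i.e., a cdf on the real line. *)
Definition F1BA (R : realType) (N : cumulativeBounded (0 : R) (1 : R))
    (gamma : R) (Sa wN : nat) (q : R) : R :=
  (2 * q * (1 - N gamma ^+ Sa)) /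
  ((1 - N gamma ^+ wN) + q * (1 + N gamma ^+ wN - N gamma ^+ Sa)).

Definition F1chance (R : realType) : R := 1 / 2.
Arguments F1chance : clear implicits.

(* Main.v *)
(* Put u = 1 - N(gamma)^|S_a|, which lies in [0, 1]. Since w_N = |S_a|, the score
   is 2qu / (u + q), and it is at most 1/2 exactly when 4qu <= u + q, i.e. when
   0 <= u (1 - 3q) + q (1 - u); both terms are nonnegative for q <= 1/3. *)
Require Import Defs.
From mathcomp Require Import all_boot all_order all_algebra.
From mathcomp Require Import all_classical all_reals all_analysis.
From mathcomp Require Import lra.
Import Order.TTheory GRing.Theory Num.Theory.
Import numFieldNormedType.Exports.
Local Open Scope ring_scope.

(** By monotonicity [f y <= f x] for all [y] close enough to -oo; let [y] tend to -oo. *)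
Lemma cumulativeBounded_ge (R : realType) (l r : R)
    (f : cumulativeBounded l r) (x : R) : l <= f x.
Proof.
apply: (cvgr_to_le (cumulativeNy f)).
near=> y; apply: cumulative_is_nondecreasing; near: y.
exact: nbhs_ninfty_le.
Unshelve. all: by end_near. Qed.

Lemma cumulativeBounded_le (R : realType) (l r : R)
    (f : cumulativeBounded l r) (x : R) : f x <= r.
Proof.
apply: (cvgr_to_ge (cumulativey f)).
near=> y; apply: cumulative_is_nondecreasing; near: y.
exact: nbhs_pinfty_ge.
Unshelve. all: by end_near. Qed.

Theorem lemma2p1 (R : realType) (N : cumulativeBounded (0 : R) (1 : R))
    (gamma : R) (Sa wN : nat) (q : R)
    (hSa : (1 <= Sa)%N) (hq : 0 < q < 1) (hwN : wN = Sa) (hq3 : q <= 1 / 3) :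
  F1BA N gamma Sa wN q <= F1chance R.
Proof.
rewrite /F1BA /F1chance hwN.
have N0 : 0 <= N gamma by exact: cumulativeBounded_ge.
have a0 : 0 <= N gamma ^+ Sa by exact: exprn_ge0.
have a1 : N gamma ^+ Sa <= 1.
  by apply: exprn_ile1 => //; exact: cumulativeBounded_le.
move: (N gamma ^+ Sa) a0 a1 => a a0 a1; have /andP[q0 _] := hq.
(* With equal widths the powers cancel and the denominator becomes [(1 - a) + q], positive since
   [0 < q]. *)
rewrite addrK mulr1 ler_pdivrMr; last lra.
(* Half the sum of this product and [q * a] is exactly the right side minus the left side of the
   goal, so [lra] closes it with [q * a] as an atom. *)
have : 0 <= (1 - a) * (1 - 3 * q) by apply: mulr_ge0; lra.
have : 0 <= q * a by apply: mulr_ge0; lra.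
lra.
Qed.
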